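(* Let $R$ be a commutative Frobenius ring with unity, let $n\geq 1$ be an integer, let $\mathbf{a},\mathbf{b},\mathbf{c}\in R^n$, and let $\lambda,\mu\in R$ satisfy $\lambda^2=\mu^2=1$. Let $A=\mathrm{circ}_{\lambda}(\mathbf{a})$ and $B=\mathrm{circ}_{\lambda}(\mathbf{b})$ be the $\lambda$-circulant matrices generated by $\mathbf{a}$ and $\mathbf{b}$, let $C=\mathrm{circ}_{\mu}(\mathbf{c})$ be the $\mu$-circulant matrix generated by $\mathbf{c}$, and let $J=J_n$ be the $n\times n$ exchange matrix. Let $$G=\begin{pmatrix} I_{2n} & X\end{pmatrix},\qquad X=\begin{pmatrix}-A^TCJ & -B\\ B^TCJ & -A\end{pmatrix}.$$ Then $G$ is a generator matrix of a self-dual $[4n,2n]$ code over $R$ if and only if both of the following hold: $$\Theta(\mathbf{a},\mathbf{a},j)[\lambda]+\Theta(\mathbf{b},\mathbf{b},j)[\lambda]=\begin{cases}-1, & j=0,\\ 0, & j\in\{1,\ldots,\lfloor n/2\rfloor\},\end{cases}$$ and $$\Theta(\mathbf{c},\mathbf{c},j)[\mu]=\begin{cases}1, & j=0,\\ 0, & j\in\{1,\ldots,\lfloor n/2\rfloor\}.\end{cases}$$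
   Context: A linear code of length $m$ over $R$ is a submodule $\mathcal{C}\subseteq R^m$; its (Euclidean) dual is $\mathcal{C}^{\perp}=\{\mathbf{x}\in R^m:\langle\mathbf{x},\mathbf{y}\rangle=0\ \forall \mathbf{y}\in\mathcal{C}\}$ with $\langle\mathbf{x},\mathbf{y}\rangle=\sum_{i=1}^m x_iy_i$; $\mathcal{C}$ is self-dual if $\mathcal{C}=\mathcal{C}^\perp$. A matrix $G=(I_{2n}\,|\,X)$ over $R$ is a generator matrix of the code in $R^{4n}$ spanned over $R$ by its rows; this is a $[4n,2n]$ code (length $4n$, generated by $2n$ rows). For $\mathbf{a}=(a_0,a_1,\ldots,a_{n-1})\in R^n$ and $\lambda\in R$, the $\lambda$-circulant matrix generated by $\mathbf{a}$ is $$\mathrm{circ}_{\lambda}(\mathbf{a})=\begin{pmatrix} a_0 & a_1 & a_2 & \cdots & a_{n-1}\\ \lambda a_{n-1} & a_0 & a_1 & \cdots & a_{n-2}\\ \lambda a_{n-2} & \lambda a_{n-1} & a_0 & \cdots & a_{n-3}\\ \vdots & \vdots & \vdots & \ddots & \vdots\\ \lambda a_1 & \lambda a_2 & \lambda a_3 & \cdots & a_0\end{pmatrix}.$$ The exchange matrix $J_n$ is the $n\times n$ matrix over $R$ whose $(i,j)$-th entry is $1$ if $i+j=n+1$ and $0$ otherwise ($1\le i,j\le n$). For an integer $k$, $[k]_n$ denotes the smallest non-negative integer congruent to $k$ modulo $n$. For $\mathbf{x}=(x_0,\ldots,x_{n-1}),\mathbf{y}=(y_0,\ldots,y_{n-1})\in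 R^n$, $j\in\{0,1,\ldots,n-1\}$ and $\lambda\in R$, define $$\Theta(\mathbf{x},\mathbf{y},j)[\lambda]=\sum_{i=0}^{n-j-1}x_{[i+j]_n}y_i+\lambda\sum_{i=n-j}^{n-1}x_{[i+j]_n}y_i,$$ where for $j=0$ the second sum is empty, so $\Theta(\mathbf{x},\mathbf{y},0)=\sum_{i=0}^{n-1}x_iy_i$. *)

(* Defs.v *)
From HB Require Import structures.
From mathcomp Require Import all_boot all_order all_algebra.

Set Implicit Arguments.
Unset Strict Implicit.
Unset Printing Implicit Defensive.

Import GRing.Theory.
Local Open Scope ring_scope.

Section Submodules.
Variables (R : pzRingType) (V : lmodType R).

(* Prop-valued, because membership need not be decidable over an abstract,
   possibly infinite ring. *)
Definition is_submodule (S : V -> Prop) : Prop :=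
  S 0 /\ forall (r : R) (x y : V), S x -> S y -> S (r *: x + y).

End Submodules.

Section Frobenius.
Variable R : comPzRingType.

Definition is_ideal (I : R -> Prop) : Prop := is_submodule (V := R^o) I.

Definition is_artinian : Prop :=
  forall I : nat -> R -> Prop,
    (forall k, is_ideal (I k)) ->
    (forall k x, I k.+1 x -> I k x) ->
    exists N, forall k, (N <= k)%N -> forall x, I k x <-> I N x.

Definition is_maximal_ideal (M : R -> Prop) : Prop :=
  [/\ is_ideal M,
      ~ M 1 &
      forall I : R -> Prop, is_ideal I -> (forall x, M x -> I x) ->
        I 1 \/ (forall x, I x -> M x)].

Definition jacobson_radical (x : R) : Prop :=
  forall M : R -> Prop, is_maximal_ideal M -> M x.

(* The minimal ideals are the simple submodules of R. *)
Definition is_minimal_ideal (M : R -> Prop) : Prop :=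
  [/\ is_ideal M,
      exists2 x, M x & x <> 0 &
      forall I : R -> Prop, is_ideal I -> (forall x, I x -> M x) ->
        (forall x, I x -> x = 0) \/ (forall x, M x -> I x)].

(* The sum of all minimal ideals, i.e. the smallest ideal containing them. *)
Definition socle (x : R) : Prop :=
  forall I : R -> Prop, is_ideal I ->
    (forall M : R -> Prop, is_minimal_ideal M -> forall y, M y -> I y) -> I x.

(* R is Artinian and Soc(R) is isomorphic to R / J(R) as an R-module. The
   isomorphism R / J(R) -> Soc(R) is given by the R-linear map f : R -> R that
   induces it: f has kernel J(R) and image Soc(R). Finiteness of R is not
   required. *)
Definition is_frobenius : Prop :=
  is_artinian /\
  exists f : {linear R^o -> R^o},
    (forall x, f x = 0 <-> jacobson_radical x) /\
    (forall y, (exists x, f x = y) <-> socle y).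

End Frobenius.

Section Codes.
Variable R : comPzRingType.

Definition is_linear_code m (C : 'rV[R]_m -> Prop) : Prop := is_submodule C.

Definition inner m (x y : 'rV[R]_m) : R := \sum_(i < m) x 0 i * y 0 i.

Definition dual_code m (C : 'rV[R]_m -> Prop) (x : 'rV[R]_m) : Prop :=
  forall y, C y -> inner x y = 0.

Definition is_self_dual m (C : 'rV[R]_m -> Prop) : Prop :=
  forall x, C x <-> dual_code C x.

(* C is the R-span of the k rows of G, so that C is an [m, k] code. *)
Definition is_generator_matrix k m (G : 'M[R]_(k, m)) (C : 'rV[R]_m -> Prop) :
    Prop :=
  forall x, C x <-> exists u : 'I_k -> R, x = \sum_(i < k) u i *: row i G.

End Codes.

Section Circulant.
Variable R : comPzRingType.

(* [k]_n as an index; the argument i only witnesses that n is positive. *)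
Definition ord_mod n (i : 'I_n) (k : nat) : 'I_n :=
  Ordinal (ltn_pmod k (leq_ltn_trans (leq0n i) (ltn_ord i))).

(* Entry (i, j) is a_(j - i) on and above the diagonal and
   lambda * a_(n + j - i) below it; both indices are [n + j - i]_n. *)
Definition circ n (lambda : R) (a : 'rV[R]_n) : 'M[R]_n :=
  \matrix_(i < n, j < n)
    (if (i <= j)%N then a 0 (ord_mod i (n + j - i))
     else lambda * a 0 (ord_mod i (n + j - i))).

(* With 1-based indices, (i + 1) + (j + 1) = n + 1. *)
Definition exchange_mx n : 'M[R]_n :=
  \matrix_(i < n, j < n) ((i + j).+1 == n)%:R.

Definition Theta n (x y : 'rV[R]_n) (j : nat) (lambda : R) : R :=
  \sum_(i < n | (i < n - j)%N) x 0 (ord_mod i (i + j)) * y 0 i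
  + lambda * \sum_(i < n | (n - j <= i)%N) x 0 (ord_mod i (i + j)) * y 0 i.

End Circulant.

Arguments exchange_mx {R} n.

(* Main.v *)
Require Import Defs.
From HB Require Import structures.
From mathcomp Require Import all_boot all_order all_algebra.
From mathcomp Require Import zify.

Set Implicit Arguments.
Unset Strict Implicit.
Unset Printing Implicit Defensive.

Import GRing.Theory.
Local Open Scope ring_scope.

(* G = (I | X) generates a self-dual code iff X X^T = -I, equivalently (over a
   commutative ring) X^T X = -I. Since A and B commute
   with each other and with their transposes, the off-diagonal blocks of X^T X
   vanish and its lower right block is A A^T + B B^T; if that is -I, the upper
   left block is -J C^T C J. So the condition is A A^T + B B^T = -I and
   C C^T = I. A symmetric matrix commuting with the lambda-circulant shift is
   determined by the entries 0, ..., n/2 of its first row, which here are the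
   values of Theta. *)

(** * Self-duality as a matrix equation *)

Lemma innerE (R : comPzRingType) m (x y : 'rV[R]_m) :
  inner x y = (x *m y^T) 0 0.
Proof. by rewrite mxE; apply: eq_bigr => i _; rewrite mxE. Qed.

Lemma inner_row (R : comPzRingType) k m (G : 'M[R]_(k, m)) x i :
  inner x (row i G) = (x *m G^T) 0 i.
Proof. by rewrite mxE; apply: eq_bigr => j _; rewrite !mxE. Qed.

Lemma generator_matrixP (R : comPzRingType) k m (G : 'M[R]_(k, m))
    (K : 'rV[R]_m -> Prop) :
  is_generator_matrix G K <->
  (forall x, K x <-> exists u : 'rV[R]_k, x = u *m G).
Proof.
split=> KG x; rewrite KG; split=> -[u ->].
- exists (\row_i u i); rewrite mulmx_sum_row.
  by apply: eq_bigr => i _; rewrite mxE.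
- by exists (fun i => u 0 i); rewrite mulmx_sum_row.
- by exists (fun i => u 0 i); rewrite mulmx_sum_row.
- exists (\row_i u i); rewrite mulmx_sum_row.
  by apply: eq_bigr => i _; rewrite mxE.
Qed.

(** Over a commutative ring a one-sided inverse of a square matrix is two-sided; the inverse of [X]
    is [- Y]. *)
Lemma mulmx_oppC (R : comPzRingType) k (X Y : 'M[R]_k) :
  X *m Y = (-1)%:M -> Y *m X = (-1)%:M.
Proof.
move=> XY; have /mulmx1C : X *m (- Y) = 1%:M.
  by rewrite mulmxN XY raddfN /= opprK.
by rewrite mulNmx raddfN /= => <-; rewrite opprK.
Qed.

(** Orthogonality of the rows of [(I | X)] amounts to [X *m X^T = -I]. The transposed equation lets
    a dual word be recovered from its left half, so the dual is no larger than the code. *)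
Lemma self_dual_systematicP (R : comPzRingType) k (X : 'M[R]_k) :
  (exists K : 'rV[R]_(k + k) -> Prop,
     [/\ is_linear_code K, is_self_dual K &
         is_generator_matrix (row_mx 1%:M X) K])
  <-> X^T *m X = (-1)%:M.
Proof.
split=> [[K [_ sdK /generator_matrixP genK]] | XTX].
  apply: mulmx_oppC; apply/matrixP=> i j.
  have rowK l : K (row l (row_mx 1%:M X)).
    by apply/genK; exists (delta_mx 0 l); rewrite -rowE.
  have /(_ _ (rowK j)) := (sdK _).1 (rowK i).
  rewrite inner_row -row_mul tr_row_mx mul_row_col trmx1 mulmx1 => /eqP.
  by rewrite !mxE addrC addr_eq0 mulNrn => /eqP.
have XXT := mulmx_oppC XTX.
pose K (x : 'rV[R]_(k + k)) := exists u : 'rV[R]_k, x = u *m row_mx 1%:M X.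
exists K; split; last exact/generator_matrixP.
  split=> [|r x y [u ->] [v ->]]; first by exists 0; rewrite mul0mx.
  by exists (r *: u + v); rewrite mulmxDl scalemxAl.
move=> x; split=> [[u ->] y [v ->]|dualx].
  rewrite innerE trmx_mul mulmxA -(mulmxA u) tr_row_mx mul_row_col trmx1 mulmx1.
  by rewrite XXT -raddfD /= subrr raddf0 mulmx0 mul0mx mxE.
have : x *m (row_mx 1%:M X)^T = 0.
  apply/rowP=> j; rewrite -inner_row mxE; apply: dualx.
  by exists (delta_mx 0 j); rewrite -rowE.
(* For [x = (l | r)], orthogonality to the rows reads [l + r X^T = 0]. The identity block forces the
   coefficient vector [l], and [l X = - r X^T X = r]. *)
rewrite -{1}[x]hsubmxK tr_row_mx mul_row_col trmx1 mulmx1 => /eqP.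
rewrite addr_eq0 => /eqP xl; exists (lsubmx x).
rewrite mul_mx_row mulmx1 {2}xl mulNmx -mulmxA XTX mul_mx_scalar scaleN1r opprK.
by rewrite hsubmxK.
Qed.

(** * The Gram matrix of the block matrix [X] *)

Lemma gram_block (R : comPzRingType) n (A B C J : 'M[R]_n) :
    A *m B = B *m A -> A^T *m A = A *m A^T -> B^T *m B = B *m B^T ->
    J^T *m J = 1%:M ->
  let X := block_mx (- (A^T *m C *m J)) (- B) (B^T *m C *m J) (- A) in
  X^T *m X = (-1)%:M
  <-> A *m A^T + B *m B^T = (-1)%:M /\ C *m C^T = 1%:M.
Proof.
move=> AB AA BB JJ X.
have JJ' := mulmx1C JJ.
have trN (M : 'M[R]_n) : (- M)^T = - M^T by apply/matrixP=> i j; rewrite !mxE.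
have XT : X^T = block_mx (- (J^T *m C^T *m A)) (J^T *m C^T *m B) (- B^T) (- A^T).
  by rewrite tr_block_mx !trN !trmx_mul !trmxK !mulmxA.
(* The off-diagonal blocks cancel by [AB]; normality of [A] and [B] turns [B^T B + A^T A] into
   [A A^T + B B^T]. *)
have -> : X^T *m X =
    block_mx (J^T *m (C^T *m (A *m A^T + B *m B^T) *m C) *m J) 0
             0 (A *m A^T + B *m B^T).
  rewrite XT mulmx_block; congr block_mx.
  - rewrite mulNmx mulmxN opprK (mulmxDr C^T) mulmxDl (mulmxDr J^T) mulmxDl.
    by rewrite !mulmxA.
  - by rewrite mulNmx !mulmxN opprK -!mulmxA AB subrr.
  - rewrite mulNmx mulmxN opprK mulNmx !mulmxA -!trmx_mul AB.
    by rewrite subrr.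
  - by rewrite !mulNmx !mulmxN !opprK AA BB addrC.
rewrite scalar_mx_block; split=> [/eq_block_mx[ul _ _ S]|[-> CC]].
  split=> //; apply: mulmx1C; move: ul.
  rewrite S mul_mx_scalar -scalemxAl -scalemxAr -scalemxAl.
  rewrite scaleN1r raddfN /= => /oppr_inj ul.
  (* Conjugation by the orthogonal [J] strips it: [C^T C = J (J^T C^T C J) J^T]. *)
  rewrite -[LHS]mul1mx -[LHS]mulmx1 -JJ' mulmxA -(mulmxA J).
  by rewrite -(mulmxA J) ul mulmx1.
congr block_mx.
rewrite mul_mx_scalar -scalemxAl -scalemxAr -scalemxAl (mulmx1C CC) mulmx1 JJ.
by rewrite scalemx1.
Qed.

Lemma exchange_mx_orthogonal (R : comPzRingType) n :
  (exchange_mx n : 'M[R]_n)^T *m exchange_mx n = 1%:M.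
Proof.
apply/matrixP=> i j; have lin := ltn_ord i; have ljn := ltn_ord j.
rewrite !mxE (bigD1 (rev_ord i)) //= big1 => [|l].
  rewrite !mxE addr0 /= (_ : (n - i.+1 + i).+1 == n); last by lia.
  by rewrite mul1r -val_eqE /=; congr (_%:R); lia.
rewrite -val_eqE !mxE /= => li.
by rewrite (_ : ((l + i).+1 == n) = false) ?mul0r //; lia.
Qed.

(** * The circulant shift [P = shift_mx 1] and the matrices commuting with it *)

Section Shift.
Variables (R : comPzRingType) (n : nat) (lambda : R).
Implicit Types (i j l : 'I_n) (M : 'M[R]_n).

(* The k-th power of the lambda-circulant shift, for k <= n. *)
Definition shift_mx (k : nat) : 'M[R]_n :=
  \matrix_(i, j) ((i + k == j)%N%:R + lambda * (i + k == j + n)%N%:R).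

Lemma val_ord_mod i k : (k < n + n)%N ->
  ord_mod i k = (if (k < n)%N then k else (k - n)%N) :> nat.
Proof.
move=> kn /=; case: ltnP => nk; first by rewrite modn_small.
by rewrite -{1}(subnK nk) modnDr modn_small //; lia.
Qed.

(** Row [i] is supported on the single column [i + k] modulo [n], with weight [lambda] once the
    index wraps. The bound on [k] ensures at most one wrap. *)
Lemma sum_shift_mx k i (F : 'I_n -> R) : (k <= n)%N ->
  \sum_l shift_mx k i l * F l =
  (if (i + k < n)%N then 1 else lambda) * F (ord_mod i (i + k)).
Proof.
move=> kn; have lin := ltn_ord i.
have vo := @val_ord_mod i (i + k) ltac:(lia).
rewrite (bigD1 (ord_mod i (i + k))) //= big1 ?addr0 => [|l].
  congr (_ * _); rewrite !mxE /= -/(val (ord_mod i (i + k))) /= in vo *.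
  rewrite vo; case: ltnP => ikn.
    by rewrite eqxx (_ : (_ == _) = false) ?mulr0 ?addr0 //; lia.
  by rewrite subnK // eqxx (_ : (_ == _) = false) ?mulr1 ?add0r //; lia.
rewrite -val_eqE /= in vo *; rewrite vo => /eqP ne.
have lln := ltn_ord l.
rewrite !mxE; have [-> ->] : (i + k == l)%N = false /\ (i + k == l + n)%N = false.
  by move: ne; case: ltnP => ?; lia.
by rewrite mulr0 addr0 mul0r.
Qed.

Lemma shift_mx0 : shift_mx 0 = 1%:M.
Proof.
apply/matrixP=> i j; have := ltn_ord i; rewrite !mxE addn0 => lin.
by rewrite (_ : (_ == j + n)%N = false) ?mulr0 ?addr0 //; lia.
Qed.

Lemma mul_shift_mx k : (k < n)%N ->
  shift_mx 1 *m shift_mx k = shift_mx k.+1.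
Proof.
move=> kn; apply/matrixP=> i j; rewrite mxE sum_shift_mx; last by lia.
have lin := ltn_ord i; have ljn := ltn_ord j.
rewrite !mxE (@val_ord_mod i (i + 1)); last by lia.
case: ltnP => i1; first by rewrite mul1r addn1 addSnnS.
rewrite (_ : (_ == j + n)%N = false); last by lia.
rewrite (_ : (i + k.+1 == j)%N = false); last by lia.
by rewrite mulr0 addr0 add0r; congr (_ * _%:R); lia.
Qed.

Lemma shift_mx_comm M k : (k <= n)%N ->
  shift_mx 1 *m M = M *m shift_mx 1 -> shift_mx k *m M = M *m shift_mx k.
Proof.
move=> + PM; elim: k => [|k IH] kn; first by rewrite shift_mx0 mul1mx mulmx1.
by rewrite -mul_shift_mx // -mulmxA IH ?(ltnW kn) // !mulmxA PM.
Qed.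

(** A circulant is a polynomial in [P] with coefficients [a], which reduces commuting with
    circulants to commuting with [P]. *)
Lemma circ_sum_shift (a : 'rV[R]_n) :
  circ lambda a = \sum_(k < n) a 0 k *: shift_mx k.
Proof.
apply/matrixP=> i j; rewrite summxE mxE.
have lin := ltn_ord i; have ljn := ltn_ord j.
have vo := @val_ord_mod i (n + j - i) ltac:(lia).
rewrite (bigD1 (ord_mod i (n + j - i))) // big1 => [|l /=].
  rewrite Monoid.mulm1 !mxE vo; case: ltnP => ij; case: ltnP => ijn; try lia.
  - rewrite (_ : (_ == j :> nat) = false); last by lia.
    by rewrite (_ : (_ == j + n)%N) ?mulr1 ?add0r 1?mulrC //; lia.
  - rewrite (_ : (_ == j :> nat)); last by lia.
    by rewrite (_ : (_ == j + n)%N = false) ?mulr0 ?addr0 ?mulr1 //; lia.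
rewrite -val_eqE /= in vo *; rewrite vo => /eqP ne; have lln := ltn_ord l.
rewrite !mxE; have [-> ->] : (i + l == j)%N = false /\ (i + l == j + n)%N = false.
  by move: ne; case: ltnP => ?; lia.
by rewrite mulr0 addr0 mulr0.
Qed.

Lemma circ_comm M (a : 'rV[R]_n) : shift_mx 1 *m M = M *m shift_mx 1 ->
  circ lambda a *m M = M *m circ lambda a.
Proof.
move=> PM; rewrite circ_sum_shift mulmx_suml mulmx_sumr; apply: eq_bigr => k _.
by rewrite -scalemxAl -scalemxAr shift_mx_comm // ltnW.
Qed.

Lemma shift_circ_comm (a : 'rV[R]_n) :
  shift_mx 1 *m circ lambda a = circ lambda a *m shift_mx 1.
Proof. by rewrite circ_comm. Qed.

(** The rows are distinct unit vectors scaled by [1] or [lambda], and both scalars square to 1. *)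
Lemma shift_mx_orthogonal : lambda ^+ 2 = 1 ->
  shift_mx 1 *m (shift_mx 1)^T = 1%:M.
Proof.
move=> l2; apply/matrixP=> i j; rewrite mxE sum_shift_mx; last first.
  by have := ltn_ord i; lia.
have lin := ltn_ord i; have ljn := ltn_ord j.
rewrite !mxE (@val_ord_mod i (i + 1)); last by lia.
rewrite -val_eqE /=; case: ltnP => i1.
  rewrite mul1r (_ : (_ == _ + n)%N = false) ?mulr0 ?addr0; last by lia.
  by congr (_%:R); lia.
rewrite (_ : (_ == i + 1 - n)%N = false); last by lia.
by rewrite add0r mulrA -expr2 l2 mul1r; congr (_%:R); lia.
Qed.

(** Transposing [P M = M P] gives [M^T P^T = P^T M^T]; multiplying by [P] on both sides removes
    [P^T], the inverse of [P]. *)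
Lemma shift_tr_comm M : lambda ^+ 2 = 1 ->
  shift_mx 1 *m M = M *m shift_mx 1 -> shift_mx 1 *m M^T = M^T *m shift_mx 1.
Proof.
move=> /shift_mx_orthogonal PP; have PP' := mulmx1C PP.
move=> /(congr1 trmx); rewrite !trmx_mul => /(congr1 (mulmx (shift_mx 1))).
move=> /(congr1 (mulmx^~ (shift_mx 1))).
by rewrite !mulmxA PP mul1mx -!mulmxA PP' mulmx1.
Qed.

(** Row 0 of [P^k] is the unit vector at [k], so row [k] of [M] is row 0 of [P^k M = M P^k]. *)
Lemma comm_shift_entry M (i0 k j : 'I_n) : i0 = 0%N :> nat ->
  shift_mx 1 *m M = M *m shift_mx 1 ->
  M k j = \sum_l M i0 l * shift_mx k l j.
Proof.
move=> i00 /(shift_mx_comm (ltnW (ltn_ord k)))/matrixP/(_ i0 j).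
rewrite !mxE sum_shift_mx ?i00 ?add0n ?ltn_ord ?mul1r; last exact/ltnW/ltn_ord.
move=> <-; congr (M _ j); apply: val_inj.
have lkn := ltn_ord k; rewrite [RHS]val_ord_mod ?ifT //; lia.
Qed.

Lemma symmetric_circulant_scalarP M (i0 : 'I_n) (s : R) : i0 = 0%N :> nat ->
    shift_mx 1 *m M = M *m shift_mx 1 -> M^T = M ->
  (M = s%:M <->
   forall j, (j <= n./2)%N -> M i0 j = if j == 0%N :> nat then s else 0).
Proof.
move=> i00 PM MT; split=> [-> j _|M0].
  by rewrite mxE -val_eqE /= i00 eq_sym; case: eqP => // _; rewrite mulr1n.
(* In the upper half, symmetry and the shift give [M_(0,j) = M_(j,0) = lambda * M_(0,n-j)], where
   [0 < n - j <= n./2]. *)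
have M0' j : M i0 j = if j == 0%N :> nat then s else 0.
  case: (leqP j n./2) => [/M0 //|jn].
  have ljn := ltn_ord j; have j0 : (0 < j)%N by lia.
  rewrite -MT mxE (comm_shift_entry (i0 := i0) _ _ i00 PM) ifN -?lt0n //.
  pose l0 := ord_mod i0 (n - j).
  have l0E : l0 = (n - j)%N :> nat by rewrite val_ord_mod ?ifT; lia.
  rewrite (bigD1 l0) //= M0 ?l0E; last by lia.
  rewrite ifN ?mul0r ?add0r; last by lia.
  rewrite big1 // => l; rewrite -val_eqE /= -/(val l0) /= in l0E *.
  rewrite l0E => ne; rewrite !mxE i00.
  have lln := ltn_ord l.
  rewrite (_ : (_ == 0)%N = false); last by lia.
  by rewrite (_ : (_ == 0 + n)%N = false) ?mulr0 ?addr0 ?mulr0 //; lia.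
(* Only the entry [s] of row 0 survives, so row [k] is [s] times row 0 of [P^k]. *)
apply/matrixP=> k j; rewrite (comm_shift_entry (i0 := i0) _ _ i00 PM).
rewrite (bigD1 i0) //= big1 ?addr0 => [|l]; last first.
  by rewrite M0' -val_eqE /= i00 => /negPf ->; rewrite mul0r.
have ljn := ltn_ord j; have lkn := ltn_ord k.
rewrite M0' i00 eqxx !mxE i00 add0n -val_eqE /=.
rewrite (_ : (_ == j + n)%N = false); last by lia.
by rewrite mulr0 addr0 mulr_natr.
Qed.

(** The entry is the sum of [a_k a_i (P^i)_(j,k)]. Exponent and row play symmetric roles,
    [(P^i)_(j,k) = (P^j)_(i,k)], so summing over [k] first pairs the shifted [a] with [a_i]. *)
Lemma circ_gram_first_row (a : 'rV[R]_n) (i0 j : 'I_n) : i0 = 0%N :> nat ->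
  (circ lambda a *m (circ lambda a)^T) i0 j = Theta a a j lambda.
Proof.
move=> i00; have ljn := ltn_ord j.
transitivity (\sum_(i < n) (if (i + j < n)%N then 1 else lambda)
                * a 0 (ord_mod i (i + j)) * a 0 i); last first.
  rewrite (bigID (fun i : 'I_n => (i < n - j)%N)) /=; congr (_ + _).
    by apply: eq_bigr => i ij; rewrite ifT ?mul1r //; lia.
  rewrite mulr_sumr; apply: eq_big => [i|i ij]; first by rewrite -leqNgt.
  by rewrite ifF ?mulrA //; lia.
rewrite mxE; under eq_bigr => k _.
  rewrite [_^T k j]mxE.
  have -> : circ lambda a i0 k = a 0 k.
    rewrite mxE i00 /= subn0; congr (a _ _); apply: val_inj => /=.
    by rewrite modnDl modn_small.
  rewrite circ_sum_shift summxE mulr_sumr.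
  over.
rewrite exchange_big /=; apply: eq_bigr => i _.
rewrite -(sum_shift_mx i (a 0)) ?mulr_suml; last exact: ltnW.
apply: eq_bigr => k _; rewrite !mxE (addnC i j).
by rewrite mulrA [LHS]mulrC mulrA.
Qed.

End Shift.

Theorem theorem3p1 (R : comPzRingType) (hR : is_frobenius R)
    (n : nat) (hn : (1 <= n)%N)
    (a b c : 'rV[R]_n) (lambda mu : R)
    (hlambda : lambda ^+ 2 = 1) (hmu : mu ^+ 2 = 1) :
  let A := circ lambda a in
  let B := circ lambda b in
  let C := circ mu c in
  let J := exchange_mx n : 'M[R]_n in
  let X := block_mx (- (A^T *m C *m J)) (- B) (B^T *m C *m J) (- A) in
  let G := row_mx (1%:M : 'M[R]_(n + n)) X in
  (exists K : 'rV[R]_((n + n) + (n + n)) -> Prop,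
     [/\ is_linear_code K, is_self_dual K & is_generator_matrix G K])
  <->
  (forall j : nat, (j <= n./2)%N ->
     Theta a a j lambda + Theta b b j lambda = if j == 0%N then -1 else 0)
  /\
  (forall j : nat, (j <= n./2)%N ->
     Theta c c j mu = if j == 0%N then 1 else 0).
Proof.
(* Writing the size as a successor makes [ord0] available as the first row. *)
case: n hn a b c => // n _ a b c A B C J X G.
have trC (x : 'rV[R]_n.+1) : shift_mx n.+1 lambda 1 *m (circ lambda x)^T =
    (circ lambda x)^T *m shift_mx n.+1 lambda 1.
  exact: shift_tr_comm (shift_circ_comm _ _).
have trCmu : shift_mx n.+1 mu 1 *m C^T = C^T *m shift_mx n.+1 mu 1.
  exact: shift_tr_comm (shift_circ_comm _ _).
rewrite self_dual_systematicP gram_block; first last.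
- exact: exchange_mx_orthogonal.
- exact/esym/circ_comm/trC.
- exact/esym/circ_comm/trC.
- exact/circ_comm/shift_circ_comm.
(* Each Gram matrix commutes with its own shift, for [lambda] or for [mu], so the first-row
   criterion applies to both. *)
have AB_gram : shift_mx n.+1 lambda 1 *m (A *m A^T + B *m B^T) =
    (A *m A^T + B *m B^T) *m shift_mx n.+1 lambda 1.
  by rewrite mulmxDr mulmxDl !mulmxA !shift_circ_comm -!mulmxA !trC.
have C_gram : shift_mx n.+1 mu 1 *m (C *m C^T) = C *m C^T *m shift_mx n.+1 mu 1.
  by rewrite mulmxA shift_circ_comm -!mulmxA trCmu.
rewrite (symmetric_circulant_scalarP (i0 := ord0) _ _ AB_gram) //; last first.
  by rewrite linearD /= !trmx_mul !trmxK.
rewrite (symmetric_circulant_scalarP (i0 := ord0) _ _ C_gram) //; last first.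
  by rewrite trmx_mul trmxK.
split=> -[hAB hC]; split=> j jn.
- have jlt : (j < n.+1)%N by lia.
  by have := hAB (Ordinal jlt) jn; rewrite mxE !circ_gram_first_row.
- have jlt : (j < n.+1)%N by lia.
  by have := hC (Ordinal jlt) jn; rewrite circ_gram_first_row.
- by rewrite mxE !circ_gram_first_row // hAB.
- by rewrite circ_gram_first_row // hC.
Qed.
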